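(* Let $\alpha:U'\to U$ be a surjective transmission of supertropical monoids, $M':=eU'$, $M:=eU$, and let $\gamma:=\alpha^\nu:M'\to M$ be its (surjective) ghost part. (i) There exist a supertropical monoid $V$ with $eV=M$ and a factorization $\alpha=\alpha_m\circ\alpha_t$, where $\alpha_t:U'\to V$ is a surjective tangible transmission covering $\gamma$, and $\alpha_m:V\to U$ is a mixing transmission over $M$. (ii) Given a factorization $\alpha=\alpha_m\alpha_t$ as described in (i), the following holds. If $\alpha=\mu\circ\beta$ with $\beta:U'\to W$ a surjective tangible transmission and $\mu:W\to U$ a fiber contraction over $M$ (in particular $eW=M$), then there exists a unique fiber contraction $\zeta:W\to V$ over $M$ such that $\zeta\beta=\alpha_t$, which forces $\alpha_m\zeta=\mu$. If in addition $\mu$ is mixing, then $\zeta$ is an isomorphism.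
   Context: A supertropical monoid is a commutative monoid $(U,\cdot)$ with absorbing element $0$ and a distinguished idempotent $e=e_U$ such that $ex=0$ implies $x=0$, together with a total ordering on $eU$ compatible with multiplication and with $0\le a$ for all $a\in eU$. $\mathcal T(U):=U\setminus eU$ (tangible elements), $\mathcal G(U):=eU\setminus\{0\}$ (nonzero ghosts). A transmission $\alpha:U\to V$ of supertropical monoids is a multiplicative map with $\alpha(0)=0$, $\alpha(1)=1$, $\alpha(e_U)=e_V$, whose restriction $\alpha^\nu:eU\to eV$ (the ghost part of $\alpha$) is order preserving. $\alpha$ covers $\gamma$ if $\alpha^\nu=\gamma$. If $eU=eV=M$, $\alpha$ is a transmission over $M$ if $\alpha(x)=x$ for all $x\in M$; a fiber contraction over $M$ is a surjective transmission over $M$. $\alpha$ is tangible if $\alpha(\mathcal T(U))\subset\mathcal T(V)\cup\{0\}$. Nonzero elements $x,y$ of $U$ are of different kind if one of them lies in $\mathcal T(U)$ and the other in $\mathcal G(U)$. A transmission $\alpha:U\to V$ is mixing if $\alpha^{-1}(0)=\{0\}$ and for any two different elements $x,y\in U\setminus\{0\}$ with $\alpha(x)=\alpha(y)$ there exists $z\in U$ with $\alpha(xz)\ne0$ (hence also $\alpha(yz)\ne0$) such that $xz$ and $yz$ are of different kind. *)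

(* Defs.v *)
From HB Require Import structures.
From mathcomp Require Import all_boot all_order.
From mathcomp Require Import boolp classical_sets functions.

Set Implicit Arguments.
Unset Strict Implicit.
Unset Printing Implicit Defensive.

Import Order.TTheory.
Local Open Scope classical_set_scope.
Local Open Scope group_scope.

Declare Scope supertropical_scope.
Delimit Scope supertropical_scope with ST.
Local Open Scope supertropical_scope.

(* The supertropical axioms are split in two structures because the order    *)
(* lives on the subtype eU, which must itself be built first.                *)
HB.mixin Record Monoid_isPreSupertropical U of Monoid U := {
  st_mulC : commutative (@mul U);
  st_zero : U;
  st_e : U;
  st_mul0 : left_zero st_zero (@mul U);
  st_ee : st_e * st_e = st_e;
  st_e_eq0 : forall x : U, st_e * x = st_zero -> x = st_zero
}.

#[short(type="preSupertropicalType")]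
HB.structure Definition PreSupertropical :=
  { U of Monoid U & Monoid_isPreSupertropical U }.

Bind Scope group_scope with PreSupertropical.sort.

Notation "0" := st_zero : supertropical_scope.
Notation "'e" := st_e (at level 0) : supertropical_scope.

#[short(type="orderMonoidType")]
HB.structure Definition OrderMonoid d := { M of Monoid M & Order.Total d M }.

Section GhostMonoid.
Variable U : preSupertropicalType.
Implicit Types x y : U.

(* the set eU; the subtype ghost below is the ordered monoid M = eU *)
Definition ghost_ideal : set U := [set 'e * x | x in [set: U]].

Record ghost := Ghost { ghost_val : U; ghost_valP : ghost_val \in ghost_ideal }.

HB.instance Definition _ := [isSub for ghost_val].
HB.instance Definition _ := [Choice of ghost by <:].

Lemma ghost_idealM : mulg_closed [pred x | x \in ghost_ideal].
Proof.
move=> _ _ /set_mem[x _ <-] /set_mem[y _ <-]; apply/mem_set.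
by exists (x * ('e * y)) => //; rewrite !mulgA.
Qed.

HB.instance Definition _ :=
  SubChoice_isSubSemigroup.Build U [pred x | x \in ghost_ideal] ghost
    ghost_idealM.

Lemma ghost_proj_subproof x : 'e * x \in ghost_ideal.
Proof. by apply/mem_set; exists x. Qed.

Definition ghost_proj x : ghost := Ghost (ghost_proj_subproof x).

Lemma ghost_projK (g : ghost) : ghost_proj (val g) = g.
Proof.
apply/val_inj => /=; case: g => _ /= /set_mem[x _ <-].
by rewrite mulgA st_ee.
Qed.

Lemma ghost_mul1g : left_id (ghost_proj 'e) (fun g h : ghost => g * h).
Proof.
move=> g; rewrite -[RHS]ghost_projK; apply/val_inj.
by rewrite valM /= st_ee.
Qed.

Lemma ghost_mulg1 : right_id (ghost_proj 'e) (fun g h : ghost => g * h).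
Proof.
move=> g; rewrite -[RHS]ghost_mul1g; apply/val_inj.
by rewrite !valM st_mulC.
Qed.

(* eU is not a submonoid of U: its unit is e *)
HB.instance Definition _ :=
  Magma_isUMagma.Build ghost ghost_mul1g ghost_mulg1.

End GhostMonoid.

Arguments ghost_ideal : clear implicits.

HB.mixin Record PreSupertropical_isSupertropical U of PreSupertropical U := {
  ghost_le : rel (ghost U);
  ghost_le_refl : reflexive ghost_le;
  ghost_le_anti : antisymmetric ghost_le;
  ghost_le_trans : transitive ghost_le;
  ghost_le_total : total ghost_le;
  ghost_le_mul : forall a b c : ghost U,
    ghost_le a b -> ghost_le (a * c) (b * c);
  ghost_le0 : forall a : ghost U, ghost_le (ghost_proj 0) a
}.

#[short(type="supertropicalType")]
HB.structure Definition Supertropical :=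
  { U of PreSupertropical U & PreSupertropical_isSupertropical U }.

Bind Scope group_scope with Supertropical.sort.

Fact ghost_display : Order.disp_t. Proof. exact: Order.Disp tt tt. Qed.

HB.instance Definition _ (U : supertropicalType) :=
  Order.Le_isPOrder.Build ghost_display (ghost U)
    ghost_le_refl ghost_le_anti ghost_le_trans.

HB.instance Definition _ (U : supertropicalType) :=
  Order.POrder_isTotal.Build ghost_display (ghost U) (@ghost_le_total U).

Section Elements.
Variable U : supertropicalType.

Definition tangibles : set U := ~` ghost_ideal U.

Definition nonzero_ghosts : set U := ghost_ideal U `\ 0.

Definition different_kind (x y : U) : Prop :=
  (tangibles x /\ nonzero_ghosts y) \/ (tangibles y /\ nonzero_ghosts x).

End Elements.

Arguments tangibles : clear implicits.
Arguments nonzero_ghosts : clear implicits.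

Section Transmissions.
Variables U V : supertropicalType.
Implicit Type f : U -> V.

(* Multiplying by e only serves to land in the subtype ghost V: f a already  *)
(* lies in eV when f is a transmission, see ghost_partE.                     *)
Definition ghost_part f (a : ghost U) : ghost V := ghost_proj (f (val a)).

Definition transmission f : Prop :=
  [/\ {morph f : x y / x * y}, f 0 = 0, f 1 = 1, f 'e = 'e
    & {homo ghost_part f : a b / (a <= b)%O}].

Lemma ghost_partE f (a : ghost U) :
  transmission f -> val (ghost_part f a) = f (val a).
Proof.
case=> fM _ _ fe _; rewrite /= -[X in f (val X)]ghost_projK /= fM fe.
by case: a => _ /= /set_mem[x _ <-]; rewrite !fM fe !mulgA !st_ee.
Qed.

Lemma ghost_part_surj f :
  transmission f -> set_surj setT setT f -> set_surj setT setT (ghost_part f).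
Proof.
move=> tf sf b _; have [x _ fx] := sf (val b) I; exists (ghost_proj x) => //.
apply/val_inj; rewrite ghost_partE //=; case: tf => fM _ _ fe _.
by rewrite fM fe fx -[RHS](congr1 val (ghost_projK b)).
Qed.

Definition tangible_transmission f : Prop :=
  transmission f /\ f @` tangibles U `<=` tangibles V `|` [set 0].

Definition mixing_transmission f : Prop :=
  [/\ transmission f,
      f @^-1` [set 0] = [set 0]
    & forall x y : U, x <> 0 -> y <> 0 -> x <> y -> f x = f y ->
        exists z : U, f (x * z) <> 0 /\ different_kind (x * z) (y * z)].

End Transmissions.

Definition isomorphism (U V : supertropicalType) (f : U -> V) : Prop :=
  transmission f /\
  exists g : V -> U, [/\ transmission g, cancel f g & cancel g f].

(* A supertropical monoid V "with eV = M": the equality of ordered monoids   *)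
(* is rendered by a chosen isomorphism ghost_id from M onto eV, and          *)
(* statements "over M" identify the elements of M along these isomorphisms.  *)
Record supertropicalOver d (M : orderMonoidType d) := SupertropicalOver {
  over_monoid :> supertropicalType;
  ghost_id : M -> ghost over_monoid;
  ghost_id_bij : bijective ghost_id;
  ghost_idM : {morph ghost_id : a b / a * b};
  ghost_id_le : {mono ghost_id : a b / (a <= b)%O}
}.

(* For M := eU itself the identification is the identity. *)
Definition over_self (U : supertropicalType) : supertropicalOver (ghost U) :=
  @SupertropicalOver _ (ghost U) U id (Bijective (fun=> erefl) (fun=> erefl))
    (fun _ _ => erefl) (fun _ _ => erefl).

Definition covers d d' (M' : orderMonoidType d') (M : orderMonoidType d)
    (U : supertropicalOver M') (V : supertropicalOver M)
    (f : U -> V) (gamma : M' -> M) : Prop :=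
  forall a : M', ghost_part f (ghost_id U a) = ghost_id V (gamma a).

Section Over.
Variables (d : Order.disp_t) (M : orderMonoidType d).
Variables U V : supertropicalOver M.
Implicit Type f : U -> V.

Definition transmission_over f : Prop :=
  transmission f /\
  forall a : M, f (val (ghost_id U a)) = val (ghost_id V a).

Definition fiber_contraction f : Prop :=
  transmission_over f /\ set_surj setT setT f.

End Over.

Definition tangible_mixing_factorization (U' U : supertropicalType)
    (alpha : U' -> U) (V : supertropicalOver (ghost U))
    (alpha_t : U' -> V) (alpha_m : V -> U) : Prop :=
  [/\ alpha = alpha_m \o alpha_t,
      tangible_transmission alpha_t /\ set_surj setT setT alpha_t,
      @covers _ _ _ _ (over_self U') V alpha_t (ghost_part alpha),
      mixing_transmission alpha_m
    & @transmission_over _ _ V (over_self U) alpha_m].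

(* Main.v *)
From HB Require Import structures.
Require Import Defs.
From mathcomp Require Import all_boot all_order.
From mathcomp Require Import boolp classical_sets functions.

(** Call x and y equivalent when [alpha x = alpha y] and no z with
    [alpha (x z) <> 0] makes xz and yz of different kind. This is a
    multiplicative congruence that identifies ghosts exactly when alpha does,
    never identifies a tangible element with a ghost unless alpha kills both,
    and separates x and y only when a mixing witness z exists. Hence its
    quotient V gives the tangible/mixing factorization. Conversely, if
    [alpha = mu beta] with beta tangible and mu injective at 0, then
    [beta x = beta y] forbids any mixing witness for the pair x, y, so beta
    factors alpha_t; applying this in both directions yields (ii). *)

Set Implicit Arguments.
Unset Strict Implicit.
Unset Printing Implicit Defensive.

Import Order.TTheory.
Local Open Scope classical_set_scope.
Local Open Scope quotient_scope.
Local Open Scope group_scope.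
Local Open Scope supertropical_scope.

(** * Ghost ideals and their images under transmissions *)

Lemma ghost_idealP (U : preSupertropicalType) (x : U) :
  ghost_ideal U x <-> 'e * x = x.
Proof.
by split=> [[y _ <-]|<-]; [rewrite mulgA st_ee | exists x].
Qed.

Lemma st_mulr0 (U : preSupertropicalType) (x : U) : x * 0 = 0.
Proof. by rewrite st_mulC st_mul0. Qed.

Lemma val_ghostP (U : preSupertropicalType) (g : ghost U) :
  'e * val g = val g.
Proof. exact: (congr1 val (ghost_projK g)). Qed.

Lemma transmission_ghost (U V : supertropicalType) (f : U -> V) (x : U) :
  transmission f -> ghost_ideal U x -> ghost_ideal V (f x).
Proof.
case=> fM _ _ fe _ /ghost_idealP ex; apply/ghost_idealP.
by rewrite -fe -fM ex.
Qed.

(** * The quotient of [U'] by the absence of mixing witnesses *)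

Section MixingQuotient.
Variables (U' U : supertropicalType) (alpha : U' -> U).
Hypothesis alpha_trans : transmission alpha.

Let alphaM : {morph alpha : x y / x * y}. Proof. by case: alpha_trans. Qed.
Let alpha0 : alpha 0 = 0. Proof. by case: alpha_trans. Qed.
Let alpha1 : alpha 1 = 1. Proof. by case: alpha_trans. Qed.
Let alphae : alpha 'e = 'e. Proof. by case: alpha_trans. Qed.

(** The guard makes both [x * z] and [y * z] nonzero, so disagreeing on membership in the ghost
    ideal is then the same as being of different kind. *)
Definition unmixed (x y : U') : Prop := alpha x = alpha y /\
  forall z, alpha (x * z) <> 0 ->
    (ghost_ideal U' (x * z) <-> ghost_ideal U' (y * z)).

Definition unmixedb : rel U' := fun x y => `[< unmixed x y >].

Lemma unmixedb_refl : reflexive unmixedb.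
Proof. by move=> x; apply/asboolP. Qed.

Lemma unmixed_sym x y : unmixed x y -> unmixed y x.
Proof.
case=> axy kxy; split=> // z; rewrite alphaM -axy -alphaM => /kxy.
by case.
Qed.

Lemma unmixedb_sym : symmetric unmixedb.
Proof. by move=> x y; apply/asboolP/asboolP; apply: unmixed_sym. Qed.

Lemma unmixedb_trans : transitive unmixedb.
Proof.
move=> y x z /asboolP[axy kxy] /asboolP[ayz kyz]; apply/asboolP.
split; first by rewrite axy.
move=> t nz; apply: (iff_trans (kxy _ nz)); apply: kyz.
by rewrite alphaM -axy -alphaM.
Qed.

Canonical unmixed_equiv :=
  EquivRel unmixedb unmixedb_refl unmixedb_sym unmixedb_trans.

Definition mixing_quotient := {eq_quot unmixed_equiv}.

HB.instance Definition _ := Choice.on mixing_quotient.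

Definition mq_pi (x : U') : mixing_quotient := \pi x.
Definition mq_lift (q : mixing_quotient) : U := alpha (repr q).

Lemma mq_piP x y : mq_pi x = mq_pi y <-> unmixed x y.
Proof.
split=> [/eqmodP/asboolP//|kxy]; exact/eqmodP/asboolP.
Qed.

Lemma mq_reprK q : mq_pi (repr q) = q.
Proof. exact: reprK. Qed.

Lemma mq_piW (P : mixing_quotient -> Prop) :
  (forall x, P (mq_pi x)) -> forall q, P q.
Proof. by move=> Ppi q; rewrite -(mq_reprK q). Qed.

Lemma mq_lift_pi x : mq_lift (mq_pi x) = alpha x.
Proof. by have /mq_piP[] := mq_reprK (mq_pi x). Qed.

Definition mq_mul (p q : mixing_quotient) := mq_pi (repr p * repr q).

Lemma unmixed_mulr w x y : unmixed x y -> unmixed (x * w) (y * w).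
Proof.
case=> axy kxy; split; first by rewrite !alphaM axy.
by move=> z; rewrite -!mulgA; apply: kxy.
Qed.

Lemma mq_mul_pi x y : mq_mul (mq_pi x) (mq_pi y) = mq_pi (x * y).
Proof.
rewrite /mq_mul; transitivity (mq_pi (x * repr (mq_pi y))).
  by apply/mq_piP/unmixed_mulr/mq_piP; rewrite mq_reprK.
by rewrite 2!(st_mulC x); apply/mq_piP/unmixed_mulr/mq_piP; rewrite mq_reprK.
Qed.

Lemma mq_mulA : associative mq_mul.
Proof.
by elim/mq_piW=> x; elim/mq_piW=> y; elim/mq_piW=> z; rewrite !mq_mul_pi mulgA.
Qed.

Lemma mq_mul1g : left_id (mq_pi 1) mq_mul.
Proof. by elim/mq_piW=> x; rewrite mq_mul_pi mul1g. Qed.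

Lemma mq_mulg1 : right_id (mq_pi 1) mq_mul.
Proof. by elim/mq_piW=> x; rewrite mq_mul_pi mulg1. Qed.

HB.instance Definition _ :=
  isMonoid.Build mixing_quotient mq_mulA mq_mul1g mq_mulg1.

Lemma mq_piM : {morph mq_pi : x y / x * y}.
Proof. by move=> x y; rewrite -mq_mul_pi. Qed.

Lemma mq_liftM : {morph mq_lift : p q / p * q}.
Proof.
by elim/mq_piW=> x; elim/mq_piW=> y; rewrite -mq_piM !mq_lift_pi alphaM.
Qed.

(** The guard [alpha (x * z) <> 0] never holds here, so the whole kernel of [alpha] collapses to the
    class of 0. This is what leaves [mq_lift] with a trivial kernel. *)
Lemma unmixed_ker x y : alpha x = 0 -> alpha y = 0 -> unmixed x y.
Proof.
by move=> ax ay; split=> [|z]; rewrite ?ax ?ay // alphaM ax st_mul0.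
Qed.

Lemma mq_mulC : commutative (@mul mixing_quotient).
Proof. by elim/mq_piW=> x; elim/mq_piW=> y; rewrite -!mq_piM st_mulC. Qed.

Lemma mq_mul0 : left_zero (mq_pi 0) (@mul mixing_quotient).
Proof. by elim/mq_piW=> x; rewrite -mq_piM st_mul0. Qed.

Lemma mq_ee : mq_pi 'e * mq_pi 'e = mq_pi 'e.
Proof. by rewrite -mq_piM st_ee. Qed.

Lemma mq_e_eq0 (q : mixing_quotient) : mq_pi 'e * q = mq_pi 0 -> q = mq_pi 0.
Proof.
elim/mq_piW: q => x; rewrite -mq_piM => /mq_piP[].
rewrite alphaM alphae alpha0 => /st_e_eq0 ax _.
exact/mq_piP/unmixed_ker.
Qed.

HB.instance Definition _ := Monoid_isPreSupertropical.Build mixing_quotient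
  mq_mulC mq_mul0 mq_ee mq_e_eq0.

(** The ghosts form an ideal, so every product [x * z] or [y * z] is again a ghost and no witness
    can exist. *)
Lemma unmixed_ghost x y : ghost_ideal U' x -> ghost_ideal U' y ->
  alpha x = alpha y -> unmixed x y.
Proof.
move=> /ghost_idealP ex /ghost_idealP ey axy; split=> // z _.
by split=> _; apply/ghost_idealP; rewrite mulgA ?ex ?ey.
Qed.

(** This is the ghost part of [mq_lift], written out because [ghost_part] presupposes an order on
    the ghosts of the quotient. That order is pulled back along this map, whose injectivity gives
    antisymmetry. *)
Definition mq_ghost (g : ghost mixing_quotient) : ghost U :=
  ghost_proj (mq_lift (val g)).

Lemma mq_ghost_pi (g : ghost mixing_quotient) :
  exists2 x, ghost_ideal U' x & val g = mq_pi x.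
Proof.
(* [repr] need not return a ghost; multiplying by ['e] does, without changing the class. *)
exists ('e * repr (val g)); first by exists (repr (val g)).
by rewrite mq_piM mq_reprK -[LHS]val_ghostP.
Qed.

Lemma val_mq_ghost g : val (mq_ghost g) = mq_lift (val g).
Proof.
have [x gx vx] := mq_ghost_pi g; rewrite /= vx mq_lift_pi.
exact/ghost_idealP/transmission_ghost.
Qed.

Lemma mq_ghost_inj : injective mq_ghost.
Proof.
move=> g h /(congr1 val); rewrite !val_mq_ghost.
have [x gx vx] := mq_ghost_pi g; have [y gy vy] := mq_ghost_pi h.
rewrite vx vy !mq_lift_pi => axy; apply/val_inj; rewrite vx vy.
exact/mq_piP/unmixed_ghost.
Qed.

Lemma mq_ghostM : {morph mq_ghost : g h / g * h}.
Proof.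
move=> g h; apply/val_inj.
by rewrite valM !val_mq_ghost valM mq_liftM.
Qed.

Definition mq_ghost_le : rel (ghost mixing_quotient) :=
  fun g h => (mq_ghost g <= mq_ghost h)%O.

Lemma mq_ghost_le_refl : reflexive mq_ghost_le.
Proof. by move=> g; apply: lexx. Qed.

Lemma mq_ghost_le_anti : antisymmetric mq_ghost_le.
Proof. by move=> g h /le_anti; apply: mq_ghost_inj. Qed.

Lemma mq_ghost_le_trans : transitive mq_ghost_le.
Proof. by move=> g h k; apply: le_trans. Qed.

Lemma mq_ghost_le_total : total mq_ghost_le.
Proof. by move=> g h; apply: le_total. Qed.

Lemma mq_ghost_le_mul (a b c : ghost mixing_quotient) :
  mq_ghost_le a b -> mq_ghost_le (a * c) (b * c).
Proof. by rewrite /mq_ghost_le !mq_ghostM; apply: ghost_le_mul. Qed.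

Lemma mq_ghost_le0 (a : ghost mixing_quotient) :
  mq_ghost_le (ghost_proj 0) a.
Proof.
rewrite /mq_ghost_le; have -> : mq_ghost (ghost_proj 0) = ghost_proj 0.
  apply/val_inj; rewrite val_mq_ghost /= -mq_piM mq_lift_pi.
  by rewrite alphaM alpha0 !st_mulr0.
exact: ghost_le0.
Qed.

HB.instance Definition _ := PreSupertropical_isSupertropical.Build
  mixing_quotient mq_ghost_le_refl mq_ghost_le_anti mq_ghost_le_trans
  mq_ghost_le_total mq_ghost_le_mul mq_ghost_le0.

Lemma mq_lift_trans : transmission mq_lift.
Proof. by split; [exact: mq_liftM | rewrite mq_lift_pi ..|]. Qed.

Lemma mq_pi_trans : transmission mq_pi.
Proof.
split=> //; first exact: mq_piM.
have ghostE a : mq_ghost (ghost_part mq_pi a) = ghost_part alpha a.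
  apply/val_inj; rewrite val_mq_ghost /= -mq_piM mq_lift_pi alphaM.
  by rewrite alphae.
(* Unfolding the pulled-back order turns the goal into monotonicity of the ghost part of [alpha]. *)
move=> a b ab; rewrite [(_ <= _)%O]/(mq_ghost_le _ _) /mq_ghost_le !ghostE.
by case: alpha_trans => _ _ _ _; apply.
Qed.

Lemma mq_lift_eq0 q : mq_lift q = 0 -> q = 0.
Proof.
by elim/mq_piW: q => x; rewrite mq_lift_pi => ax; apply/mq_piP/unmixed_ker.
Qed.

Lemma mq_pi_tangible x :
  alpha x <> 0 -> tangibles U' x -> tangibles mixing_quotient (mq_pi x).
Proof.
(* If the class of [x] were a ghost, ['e * x] and [x] would be unmixed. Testing with [z = 1] would
   then make [x] itself a ghost, since [alpha ('e * x)] is nonzero. *)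
move=> ax tx /ghost_idealP; rewrite -mq_piM => /mq_piP[_ /(_ 1)].
rewrite !mulg1 alphaM alphae; apply: contra_not tx; case=> [/st_e_eq0//|+ _].
by apply; exists x.
Qed.

Lemma mq_pi_tangible_trans : tangible_transmission mq_pi.
Proof.
split; first exact: mq_pi_trans.
move=> _ [x tx <-]; have [ax|ax] := pselect (alpha x = 0).
  by right; apply: mq_lift_eq0; rewrite mq_lift_pi.
by left; apply: mq_pi_tangible.
Qed.

Lemma mq_pi_kind x y : alpha x <> 0 -> alpha x = alpha y ->
  tangibles U' x -> ghost_ideal U' y -> different_kind (mq_pi x) (mq_pi y).
Proof.
move=> ax axy tx gy; left; split; first exact: mq_pi_tangible.
split; first exact: (transmission_ghost mq_pi_trans).
by move/(congr1 mq_lift); rewrite !mq_lift_pi alpha0 -axy.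
Qed.

Lemma mq_lift_mixing : mixing_transmission mq_lift.
Proof.
split; first exact: mq_lift_trans.
  apply/seteqP; split=> [q /mq_lift_eq0 //|_ ->] /=.
  by rewrite mq_lift_pi.
elim/mq_piW=> x; elim/mq_piW=> y _ _ nxy; rewrite !mq_lift_pi => axy.
(* If [x * z] and [y * z] are of different kind in [U'], their classes are of different kind too, so
   the class of [z] is a mixing witness in the quotient. *)
apply: contrapT => nomix; apply/nxy/mq_piP; split=> // z az.
apply: contrapT => nk; apply: nomix; exists (mq_pi z).
rewrite -!mq_piM mq_lift_pi; split=> //.
have axyz : alpha (x * z) = alpha (y * z) by rewrite !alphaM axy.
have [gx|tx] := pselect (ghost_ideal U' (x * z)).
  have [gy|ty] := pselect (ghost_ideal U' (y * z)); first by case: nk.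
  by apply/or_comm/mq_pi_kind; rewrite -?axyz.
have [gy|ty] := pselect (ghost_ideal U' (y * z)); last by case: nk.
exact: mq_pi_kind.
Qed.

End MixingQuotient.

Arguments mq_ghost {U' U alpha} alpha_trans g.
Arguments mq_lift {U' U alpha} alpha_trans q.

(** * Existence of the factorization *)

Lemma tangible_mixing_factorization_exists (U' U : supertropicalType)
    (alpha : U' -> U) :
  transmission alpha -> set_surj setT setT alpha ->
  exists (V : supertropicalOver (ghost U)) (alpha_t : U' -> V)
    (alpha_m : V -> U), tangible_mixing_factorization alpha alpha_t alpha_m.
Proof.
move=> ta sa.
have lift_surj : set_surj setT setT (mq_lift ta).
  move=> u _; have [x _ <-] := sa u I; exists (mq_pi ta x) => //.
  exact: mq_lift_pi.
have : bijective (mq_ghost ta).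
  rewrite -setTT_bijective; split=> //.
    by move=> g h _ _; apply: mq_ghost_inj.
  exact: (ghost_part_surj (mq_lift_trans ta)).
case=> h hK Kh.
have hM : {morph h : a b / a * b}.
  by move=> a b; apply: (can_inj hK); rewrite Kh mq_ghostM !Kh.
have h_le : {mono h : a b / (a <= b)%O}.
  by move=> a b; rewrite -{2}(Kh a) -{2}(Kh b).
(* Identifying [eU] with the ghosts of the quotient by the inverse of [mq_ghost] makes [mq_lift] the
   identity over [eU]. *)
exists (SupertropicalOver (Bijective Kh hK) hM h_le), (mq_pi ta),
  (mq_lift ta).
split=> /=.
- by apply/funext => x /=; rewrite mq_lift_pi.
- split; first exact: mq_pi_tangible_trans.
  by move=> q _; exists (repr q) => //; apply: mq_reprK.
- move=> a /=; apply: (can_inj hK); rewrite Kh; apply/val_inj.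
  by rewrite val_mq_ghost !ghost_partE ?mq_lift_pi //; apply: mq_pi_trans.
- exact: mq_lift_mixing.
- split=> [|a]; first exact: mq_lift_trans.
  by rewrite -val_mq_ghost Kh.
Qed.

(** * The universal property of the factorization *)

(** Where its value is nonzero, a tangible transmission both preserves and reflects ghosts. A
    difference of kind after [alpha_t] therefore already exists between [x] and [y], and it would
    persist after [beta], where their images coincide. *)
Lemma tangible_not_different_kind (U' V W : supertropicalType)
    (alpha_t : U' -> V) (beta : U' -> W) (x y : U') :
  tangible_transmission alpha_t -> tangible_transmission beta ->
  beta x = beta y -> beta x <> 0 -> alpha_t x <> 0 -> alpha_t y <> 0 ->
  ~ different_kind (alpha_t x) (alpha_t y).
Proof.
move=> [tt at_] [tb bt] + + + +.
wlog tx : x y / tangibles V (alpha_t x) /\ nonzero_ghosts V (alpha_t y).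
  move=> wl bxy bx ax ay [k|k]; first by apply: (wl x y) => //; left.
  by apply: (wl y x) => //; [rewrite -bxy | left].
case: tx => tx [gy _] bxy bx _ ay _.
have tx' : tangibles U' x by apply: contra_not tx; apply: transmission_ghost.
have gy' : ghost_ideal U' y.
  apply: contrapT => ty.
  by have [] := at_ _ (ex_intro2 _ _ y ty erefl).
have [] := bt _ (ex_intro2 _ _ x tx' erefl) => //; apply.
by rewrite bxy; apply: transmission_ghost.
Qed.

Section Factor.
Variables (U' U : supertropicalType) (alpha : U' -> U).
Variables (V W : supertropicalOver (ghost U)).
Variables (alpha_t : U' -> V) (alpha_m : V -> U).
Variables (beta : U' -> W) (mu : W -> U).
Hypothesis alphaE : alpha = alpha_m \o alpha_t.
Hypothesis tt : tangible_transmission alpha_t.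
Hypothesis st : set_surj setT setT alpha_t.
Hypothesis mixm : mixing_transmission alpha_m.
Hypothesis overm : @transmission_over _ _ V (over_self U) alpha_m.
Hypothesis alphaE' : alpha = mu \o beta.
Hypothesis tb : tangible_transmission beta.
Hypothesis sb : set_surj setT setT beta.
Hypothesis overmu : @transmission_over _ _ W (over_self U) mu.

(** Were the two images distinct, a mixing witness for [alpha_m] would exist; it lifts to some [z]
    in [U'] along the surjection [alpha_t]. Then [x * z] and [y * z] agree under [beta], yet their
    images under [alpha_t] differ in kind. *)
Lemma factor_eq x y : beta x = beta y -> alpha_t x = alpha_t y.
Proof.
have [[tmM tm0 _ _ _] m0 mix] := mixm.
have [[tbM _ _ _ _] _] := tb; have [[ttM _ _ _ _] _] := tt.
have [[_ mu0 _ _ _] _] := overmu.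
have mt z : alpha_m (alpha_t z) = mu (beta z).
  by rewrite -[LHS]/((alpha_m \o alpha_t) z) -alphaE alphaE'.
have m_eq0 v : alpha_m v = 0 -> v = 0.
  by move=> mv; have : (alpha_m @^-1` [set 0]) v by []; rewrite m0.
move=> bxy; have mxy : alpha_m (alpha_t x) = alpha_m (alpha_t y).
  by rewrite !mt bxy.
apply: contrapT => nxy.
have [] := mix (alpha_t x) (alpha_t y) => //.
- move=> x0; apply: nxy; rewrite x0; apply/esym/m_eq0.
  by rewrite -mxy x0.
- move=> y0; apply: nxy; rewrite y0; apply/m_eq0.
  by rewrite mxy y0.
move=> v; have [z _ <-] := st (I : setT v); rewrite -!ttM => -[nz].
have mz : alpha_m (alpha_t (y * z)) = alpha_m (alpha_t (x * z)).
  by rewrite !ttM !tmM mxy.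
apply: (tangible_not_different_kind tt tb); first by rewrite !tbM bxy.
- by move=> b0; apply: nz; rewrite mt b0.
- by move=> a0; apply: nz; rewrite a0.
- by move=> a0; apply: nz; rewrite -mz a0.
Qed.

Lemma factor_fiber_contraction (zeta : W -> V) :
  zeta \o beta = alpha_t -> fiber_contraction zeta.
Proof.
move=> zb; have zbE x : zeta (beta x) = alpha_t x by rewrite -zb.
have [[tbM tb0 tb1 tbe _] _] := tb; have [[ttM tt0 tt1 tte _] _] := tt.
have [_ overmE] := overm; have [_ overmuE] := overmu.
have zM : {morph zeta : p q / p * q}.
  move=> p q; have [x _ <-] := sb (I : setT p).
  by have [y _ <-] := sb (I : setT q); rewrite -tbM !zbE.
have ze : zeta 'e = 'e by rewrite -tbe zbE.
have mz w : alpha_m (zeta w) = mu w.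
  have [x _ <-] := sb (I : setT w); rewrite zbE.
  by rewrite -[LHS]/((alpha_m \o alpha_t) x) -alphaE alphaE'.
(* The value is a ghost of [V], hence comes from some element of [eU]. As [alpha_m] and [mu] both
   undo the identifications with [eU], the equation [mz] forces that element to be [a]. *)
have zid a : zeta (val (ghost_id W a)) = val (ghost_id V a).
  set v := zeta _; have [h hK Kh] := ghost_id_bij V.
  have ev : 'e * v = v by rewrite -ze -zM val_ghostP.
  have vE : v = val (ghost_id V (h (ghost_proj v))) by rewrite Kh /= ev.
  rewrite vE; congr (val (ghost_id V _)); apply: val_inj.
  by have := overmE (h (ghost_proj v)); rewrite -vE mz overmuE /= => ->.
split; last first.
  by move=> v _; have [x _ <-] := st (I : setT v); exists (beta x).
split=> //; split=> //; [by rewrite -tb0 zbE | by rewrite -tb1 zbE |].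
have zgh a : ghost_part zeta (ghost_id W a) = ghost_id V a.
  by apply: val_inj; rewrite /= zid val_ghostP.
have [h hK Kh] := ghost_id_bij W.
by move=> a b; rewrite -(Kh a) -(Kh b) !zgh !ghost_id_le.
Qed.

(** Compose [alpha_t] with a chosen section of [beta]; by [factor_eq] the choice does not affect the
    value. *)
Lemma factor_exists : exists zeta : W -> V, zeta \o beta = alpha_t.
Proof.
have [r rK] : {r : W -> U' & forall w, beta (r w) = w}.
  apply: (@choice W U' (fun w x => beta x = w)) => w.
  by have [x _ <-] := sb (I : setT w); exists x.
by exists (alpha_t \o r); apply/funext => x; apply: factor_eq; rewrite rK.
Qed.

End Factor.

Theorem theorem3p10 (U' U : supertropicalType) (alpha : U' -> U)
    (alpha_trans : transmission alpha)
    (alpha_surj : set_surj setT setT alpha) :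
  (* (i) *)
  (exists (V : supertropicalOver (ghost U))
          (alpha_t : U' -> V) (alpha_m : V -> U),
      tangible_mixing_factorization alpha alpha_t alpha_m)
  /\
  (* (ii) *)
  (forall (V : supertropicalOver (ghost U))
          (alpha_t : U' -> V) (alpha_m : V -> U),
      tangible_mixing_factorization alpha alpha_t alpha_m ->
    forall (W : supertropicalOver (ghost U)) (beta : U' -> W) (mu : W -> U),
      alpha = mu \o beta ->
      tangible_transmission beta -> set_surj setT setT beta ->
      @fiber_contraction _ _ W (over_self U) mu ->
      (exists! zeta : W -> V, fiber_contraction zeta /\ zeta \o beta = alpha_t)
      /\
      (forall zeta : W -> V,
          fiber_contraction zeta -> zeta \o beta = alpha_t ->
          alpha_m \o zeta = mu /\
          (mixing_transmission mu -> isomorphism zeta))).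
Proof.
split; first exact: tangible_mixing_factorization_exists.
move=> V alpha_t alpha_m [aE [tt st] _ mixm overm].
move=> W beta mu aE' tb sb [overmu _].
(* Right cancellation of the surjection [beta] yields both the uniqueness of [zeta] and the forced
   identity with [mu]. *)
have epi T (f g : W -> T) : f \o beta = g \o beta -> f = g.
  move=> fg; apply/funext => w; have [x _ <-] := sb w I.
  exact: (congr1 (@^~ x) fg).
split.
  have [zeta zb] := factor_exists aE tt st mixm aE' tb sb overmu.
  exists zeta; split.
    by split=> //;
      apply: (factor_fiber_contraction aE tt st overm aE' tb sb overmu).
  by move=> zeta' [_ z'b]; apply: epi; rewrite zb z'b.
move=> zeta [[tz _] _] zb; split.
  by apply: epi; rewrite -compA zb -aE.
move=> mixmu; split=> //.
(* When [mu] is mixing the two factorizations play symmetric roles. Exchanging them gives a map from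
   [V] to [W], inverse to [zeta] because [beta] and [alpha_t] are surjective. *)
have [xi xE] := factor_exists aE' tb sb mixmu aE tt st overm.
exists xi.
have [[tx _] _] :=
  factor_fiber_contraction aE' tb sb overmu aE tt st overm xE.
split=> // [w|v].
  have [x _ <-] := sb w I.
  by have := xE; rewrite -zb => /(congr1 (@^~ x)).
have [x _ <-] := st v I.
by have := zb; rewrite -xE => /(congr1 (@^~ x)).
Qed.
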